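(* Let $(\mathcal G(A,D),p)$ be a framework in $\mathbb R^2$. The following statements are equivalent: 1) $(\mathcal G(A,D),p)$ is globally SA-RoD rigid. 2) The shape of $(\mathcal G(A,D),p)$ can be uniquely determined by $\{\alpha_{ijk}:(i,j,k)\in\mathcal T_A\}$ and $\{\kappa_{ijk}:(i,j,k)\in\mathcal T_D\}$ up to uniform rotations, translations, and scalings. 3) All SAs in $\{\alpha_{ijk}:(i,j,k)\in\mathcal T_{\mathcal G}\}$ and RoDs in $\{\kappa_{ijk}:(i,j,k)\in\mathcal T_{\mathcal G}\}$ can be uniquely determined by $\{\alpha_{ijk}:(i,j,k)\in\mathcal T_A\}$ and $\{\kappa_{ijk}:(i,j,k)\in\mathcal T_D\}$. 4) All SAs in $\{\alpha_{ijk}:(i,j,k)\in\mathcal T_{\mathcal K}\}$ and RoDs in $\{\kappa_{ijk}:(i,j,k)\in\mathcal T_{\mathcal K}\}$ can be uniquely determined by $\{\alpha_{ijk}:(i,j,k)\in\mathcal T_A\}$ and $\{\kappa_{ijk}:(i,j,k)\in\mathcal T_D\}$.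
   Context: $\mathcal{G}=(\mathcal V,\mathcal E)$ is a finite simple undirected graph, $\mathcal V=\{1,\dots,n\}$, $n\ge 3$. A node bipartition is $\mathcal V=\mathcal V_A\cup\mathcal V_D$ with $\mathcal V_A,\mathcal V_D$ disjoint and nonempty; $\mathcal G(A,D)$ is $\mathcal G$ with this bipartition, and $\mathcal K(A,D)$ is the complete graph on $\mathcal V$ with the same bipartition. A framework $(\mathcal G(A,D),p)$ has configuration $p=(p_1^\top,\dots,p_n^\top)^\top\in\mathbb R^{2n}$ with pairwise distinct $p_i\in\mathbb R^2$. $b_{ij}=(p_j-p_i)/\|p_j-p_i\|$. $\mathcal T_{\mathcal G}=\{(u,v,w)\in\mathcal V^3:(u,v),(u,w)\in\mathcal E,v<w\}$; $\mathcal T_A$ (resp. $\mathcal T_D$) is the set of $(u,v,w)\in\mathcal T_{\mathcal G}$ with $u\in\mathcal V_A$ (resp. $u\in\mathcal V_D$); $\mathcal T_{\mathcal K}$ is the analogue of $\mathcal T_{\mathcal G}$ for the complete graph. $\alpha_{ijk}\in[0,2\pi)$ (SA) is the signed angle from $b_{ij}$ to $b_{ik}$ counter-clockwise; $\kappa_{ijk}=\|p_k-p_i\|/\|p_j-p_i\|$ (RoD). The SA-RoD rigidity function is $f_{\mathcal G(A,D)}(p)=(\ldots,\alpha_{rst},\ldots,\kappa_{ijk},\ldots)^\top$, $(r,s,t)\in\mathcal T_A,(i,j,k)\in\mathcal T_D$, defined at every configuration in which adjacent vertices are distinct; $f_{\mathcal K(A,D)}$ is defined likewise for $\mathcal K$.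 The framework is globally SA-RoD rigid if $f^{-1}_{\mathcal{G}(A,D)}(f_{\mathcal{G}(A,D)}(p))=f^{-1}_{\mathcal{K}(A,D)}(f_{\mathcal{K}(A,D)}(p))$. ''Shape uniquely determined up to uniform rotations, translations, and scalings'' means every $q$ with $f_{\mathcal G(A,D)}(q)=f_{\mathcal G(A,D)}(p)$ satisfies $q=\mathbf 1_n\otimes\xi+c(I_n\otimes\mathcal R(\theta))p$ for some $\xi\in\mathbb R^2$, $\theta\in[0,2\pi)$, $c>0$, where $\mathcal R(\theta)$ is the rotation matrix. A family of SAs/RoDs is ''uniquely determined'' by the given data if every $q$ with $f_{\mathcal G(A,D)}(q)=f_{\mathcal G(A,D)}(p)$ has these SAs/RoDs defined and equal to those of $p$.
   Formalization: The implication from 3) to 1) is proved only for connected graphs, since it fails for disconnected ones (with no edges, 3) holds vacuously while 1), 2), 4) fail); the equivalence of 1), 2), 4) and the implication from 1) to 3) are proved for every graph. *)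

(* Defs.v *)
From mathcomp Require Import all_boot all_order all_algebra.
From mathcomp Require Import boolp classical_sets reals trigo.
From mathcomp Require Import ring lra.

Set Implicit Arguments.
Unset Strict Implicit.
Unset Printing Implicit Defensive.

Import Order.TTheory GRing.Theory Num.Theory.
Local Open Scope ring_scope.

Section Plane.
Variable R : realType.
Implicit Types u v : 'cV[R]_2.

Definition dot2 u v : R := u 0 0 * v 0 0 + u 1 0 * v 1 0.

Definition cross2 u v : R := u 0 0 * v 1 0 - u 1 0 * v 0 0.

(* Euclidean; the library norm on matrices is the sup norm. *)
Definition norm2 v : R := Num.sqrt (dot2 v v).

Definition rot2 (theta : R) : 'M[R]_2 :=
  \matrix_(i, j) (if i == j then cos theta
                  else if i == 0 then - sin theta else sin theta).

(* The counter-clockwise angle in [0, 2 pi[ from the unit vector u to the unit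
   vector v; signed_angleP and signed_angle_unique characterize it. *)
Definition signed_angle u v : R :=
  if 0 <= cross2 u v then acos (dot2 u v) else pi *+ 2 - acos (dot2 u v).

Lemma norm2_1 v : norm2 v = 1 -> dot2 v v = 1.
Proof.
move=> v1; rewrite -[LHS]sqr_sqrtr; first by rewrite -/(norm2 v) v1 expr1n.
by rewrite /dot2 addr_ge0 // -expr2 sqr_ge0.
Qed.

Lemma rot2_mulE theta u :
  ((rot2 theta *m u) 0 0 = cos theta * u 0 0 - sin theta * u 1 0) *
  ((rot2 theta *m u) 1 0 = sin theta * u 0 0 + cos theta * u 1 0).
Proof.
have -> : (1 : 'I_2) = lift ord0 ord0 by apply/val_inj.
by split; rewrite mxE !big_ord_recl big_ord0 !mxE /= ?mulNr addr0.
Qed.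

Lemma col2P u v : u 0 0 = v 0 0 -> u 1 0 = v 1 0 -> u = v.
Proof.
move=> e0 e1; apply/matrixP => i j; rewrite ord1.
by case: i => [[|[|//]] i2]; [move: e0|move: e1]; congr (u _ _ = v _ _);
  apply/val_inj.
Qed.

Lemma lagrange2 u v : norm2 u = 1 -> norm2 v = 1 ->
  dot2 u v ^+ 2 + cross2 u v ^+ 2 = 1.
Proof.
move=> /norm2_1 u1 /norm2_1 v1.
transitivity (dot2 u u * dot2 v v); first by rewrite /dot2 /cross2; ring.
by rewrite u1 v1 mulr1.
Qed.

Lemma cos_sin_signed_angle u v : norm2 u = 1 -> norm2 v = 1 ->
  [/\ 0 <= signed_angle u v < pi *+ 2, cos (signed_angle u v) = dot2 u v
    & sin (signed_angle u v) = cross2 u v].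
Proof.
move=> u1 v1; have L := lagrange2 u1 v1.
set d := dot2 u v in L *; set c := cross2 u v in L *.
have d_itv : -1 <= d <= 1 by apply/andP; split; nra.
have cosd : cos (acos d) = d by rewrite acosK // in_itv.
have sind : sin (acos d) = `|c|.
  by rewrite sin_acos // -sqrtr_sqr; congr Num.sqrt; rewrite -L; ring.
have a0 := acos_ge0 d_itv; have api := acos_lepi d_itv.
have pi0 := pi_gt0 R.
rewrite /signed_angle -/d -/c; case: ifPn => [c0|].
  by rewrite cosd sind ger0_norm //; split => //; apply/andP; split; lra.
rewrite -ltNge => c0.
rewrite cosB sinB cos2pi sin2pi cosd sind ltr0_norm //; split; [|ring|ring].
have d1 : d < 1 by nra.
have : 0 < acos d by apply: acos_gt0; move: d_itv => /andP[-> _].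
by move=> ?; apply/andP; split; lra.
Qed.

Lemma signed_angleP u v : norm2 u = 1 -> norm2 v = 1 ->
  0 <= signed_angle u v < pi *+ 2 /\ v = rot2 (signed_angle u v) *m u.
Proof.
move=> u1 v1; have [th cth sth] := cos_sin_signed_angle u1 v1; split => //.
have := norm2_1 u1; rewrite /dot2 => uu.
apply: col2P; rewrite rot2_mulE cth sth /dot2 /cross2.
  by rewrite -[LHS]mul1r -uu; ring.
by rewrite -[LHS]mul1r -uu; ring.
Qed.

Lemma signed_angle_unique u v theta : norm2 u = 1 -> norm2 v = 1 ->
  0 <= theta < pi *+ 2 -> v = rot2 theta *m u -> signed_angle u v = theta.
Proof.
move=> u1 v1 /andP[th0 th2] vE.
have uu := norm2_1 u1.
have dE : dot2 u v = cos theta.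
  by rewrite vE /dot2 !rot2_mulE -[RHS]mulr1 -uu /dot2; ring.
have cE : cross2 u v = sin theta.
  by rewrite vE /cross2 !rot2_mulE -[RHS]mulr1 -uu /dot2; ring.
rewrite /signed_angle dE cE.
have pi0 := pi_gt0 R.
have [thpi|thpi] := leP theta pi.
  by rewrite sin_ge0_pi ?th0 // cosK // in_itv /= th0.
have th' : 0 < pi *+ 2 - theta < pi by apply/andP; split; lra.
have s' : sin (pi *+ 2 - theta) = - sin theta.
  by rewrite sinB cos2pi sin2pi; ring.
have c' : cos (pi *+ 2 - theta) = cos theta.
  by rewrite cosB cos2pi sin2pi; ring.
have := sin_gt0_pi th'; rewrite s' oppr_gt0 => /lt_geF ->.
rewrite -c' cosK; first by ring.
by rewrite in_itv /=; move: th' => /andP[/ltW -> /ltW ->].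
Qed.

End Plane.

Section Framework.
Variables (R : realType) (n : nat).

Local Notation vertex := 'I_n.
Local Notation triple := ('I_n * 'I_n * 'I_n)%type.
Definition config := 'I_n -> 'cV[R]_2.

Implicit Types (e : rel vertex) (A D S : {set vertex}) (p q : config).

Definition complete_graph : rel vertex := [rel u v | u != v].

Definition connected_graph e : Prop := forall u v, connect e u v.

Definition bipartition A D : Prop :=
  [/\ A != finset.set0, D != finset.set0, A :|: D = [set: 'I_n]%SET
    & A :&: D = finset.set0].

Definition triples e : {set triple} :=
  [set t : triple | [&& e t.1.1 t.1.2, e t.1.1 t.2 & (t.1.2 < t.2)%N]]%SET.

Definition triples_at e S : {set triple} :=
  [set t in triples e | t.1.1 \in S]%SET.

Definition bearing p (i j : vertex) : 'cV[R]_2 :=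
  (norm2 (p j - p i))^-1 *: (p j - p i).

Definition SA p (t : triple) : R :=
  let: (i, j, k) := t in signed_angle (bearing p i j) (bearing p i k).

Definition RoD p (t : triple) : R :=
  let: (i, j, k) := t in norm2 (p k - p i) / norm2 (p j - p i).

(* The total functions SA and RoD are meaningful only when the two neighbours
   are placed away from the centre of the triple. *)
Definition SA_RoD_defined p (t : triple) : Prop :=
  let: (i, j, k) := t in p j <> p i /\ p k <> p i.

Definition adjacent_distinct e p : Prop := forall i j, e i j -> p i <> p j.

Definition SA_RoD_fun e A D p :
    {ffun {t | t \in triples_at e A} -> R} *
    {ffun {t | t \in triples_at e D} -> R} :=
  ([ffun t => SA p (val t)], [ffun t => RoD p (val t)]).

(* The preimage of f(p) under the partial function f = SA_RoD_fun e A D, whose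
   domain is adjacent_distinct e. *)
Definition SA_RoD_fiber e A D p : set config :=
  [set q | adjacent_distinct e q /\
           SA_RoD_fun e A D q = SA_RoD_fun e A D p]%classic.

Definition globally_SA_RoD_rigid e A D p : Prop :=
  SA_RoD_fiber e A D p = SA_RoD_fiber complete_graph A D p.

Definition directly_similar p q : Prop :=
  exists (xi : 'cV[R]_2) (theta c : R),
    [/\ 0 <= theta < pi *+ 2, 0 < c &
        forall i, q i = xi + c *: (rot2 theta *m p i)].

Definition shape_determined e A D p : Prop :=
  forall q, SA_RoD_fiber e A D p q -> directly_similar p q.

Definition SA_RoD_determined e A D p (T : {set triple}) : Prop :=
  forall q, SA_RoD_fiber e A D p q -> forall t, t \in T ->
    [/\ SA_RoD_defined q t, SA q t = SA p t & RoD q t = RoD p t].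

End Framework.

Arguments complete_graph {n}.

(* Signed angles and ratios at the vertices of G carry no information on the
   relative placement of two connected components.  The edgeless graph has no
   triples at all: its own angles and ratios are vacuously determined, while its
   shape is not.  So the former implies the latter only for connected graphs. *)
Lemma edgeless_triples_determined (R : realType) (n : nat)
    (A D : {set 'I_n}) (p : config R n) (e : rel 'I_n := fun _ _ => false) :
  SA_RoD_determined e A D p (triples e).
Proof. by move=> q _ t; rewrite inE. Qed.

Lemma edgeless_shape_not_determined (R : realType) (n : nat)
    (A D : {set 'I_n}) (p : config R n) (e : rel 'I_n := fun _ _ => false) :
  (1 < n)%N -> injective p -> ~ shape_determined e A D p.
Proof.
move=> n1 p_inj /(_ (fun=> 0)) [|xi [theta [c [_ c0 qE]]]].
  split=> //; congr pair; apply/ffunP => -[t ht]; exfalso;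
    by move: ht; rewrite !inE.
pose i : 'I_n := Ordinal (ltnW n1); pose j : 'I_n := Ordinal n1.
suff : i = j by move=> /(congr1 val).
apply: p_inj; have := qE i; rewrite (qE j) => /addrI.
have c_neq0 : c != 0 by rewrite gt_eqF.
move=> /(scalerI c_neq0) /= E.
have sc := cos2Dsin2 theta.
have E0 := congr1 (fun w : 'cV[R]_2 => w 0 0) E.
have E1 := congr1 (fun w : 'cV[R]_2 => w 1 0) E.
rewrite !rot2_mulE in E0 E1.
apply: col2P.
  transitivity (cos theta * (cos theta * p i 0 0 - sin theta * p i 1 0)
      + sin theta * (sin theta * p i 0 0 + cos theta * p i 1 0)).
    by rewrite -[LHS]mul1r -sc; ring.
  by rewrite -E0 -E1 -[RHS]mul1r -sc; ring.
transitivity (- sin theta * (cos theta * p i 0 0 - sin theta * p i 1 0)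
    + cos theta * (sin theta * p i 0 0 + cos theta * p i 1 0)).
  by rewrite -[LHS]mul1r -sc; ring.
by rewrite -E0 -E1 -[RHS]mul1r -sc; ring.
Qed.

(* Main.v *)
Require Import Defs.
From mathcomp Require Import all_boot all_order all_algebra.
From mathcomp Require Import boolp classical_sets reals trigo.
From mathcomp Require Import ring lra.

(** The heart of the matter is that on the complete graph the SA-RoD data pin
    down the shape.  Pick [a] in [A] and [d] in [D], and let [z] be the complex
    ratio [(q d - q a) / (p d - p a)].  For any third vertex [v], the angle at
    [a] and the ratio at [d] leave at most two positions for [q v] on a ray from
    [q a], and the datum at [v], whichever its kind, leaves only
    [q v - q a = z (p v - p a)].  Hence global rigidity means that the fiber of
    [G] consists of direct similarities.  When all angles and ratios of a
    connected [G] are determined, each star is scaled by one complex ratio, and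
    this ratio propagates along edges. *)

Set Implicit Arguments.
Unset Strict Implicit.
Unset Printing Implicit Defensive.

Import Order.TTheory GRing.Theory Num.Theory.
Local Open Scope ring_scope.

(** * Plane vectors as complex numbers: products, lengths, angles and ratios *)

Section PlaneGeometry.
Variable R : realType.
Implicit Types (u v : 'cV[R]_2) (z : R * R).

Lemma dot2_ge0 u : 0 <= dot2 u u.
Proof. by rewrite /dot2 addr_ge0 // -expr2 sqr_ge0. Qed.

Lemma dot2_gt0 u : u != 0 -> 0 < dot2 u u.
Proof.
move=> u0; rewrite lt0r dot2_ge0 andbT; apply: contra u0 => /eqP.
rewrite /dot2 => E; apply/eqP; apply: col2P; rewrite !mxE; nra.
Qed.

Lemma sqr_norm2 u : norm2 u ^+ 2 = dot2 u u.
Proof. by rewrite sqr_sqrtr ?dot2_ge0. Qed.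

Lemma norm2_gt0 u : u != 0 -> 0 < norm2 u.
Proof. by move=> /dot2_gt0; rewrite sqrtr_gt0. Qed.

Lemma dot2Z a b u v : dot2 (a *: u) (b *: v) = a * b * dot2 u v.
Proof. by rewrite /dot2 ?/w !mxE; ring. Qed.

Lemma cross2Z a b u v : cross2 (a *: u) (b *: v) = a * b * cross2 u v.
Proof. by rewrite /cross2 !mxE; ring. Qed.

Lemma norm2Z a u : 0 <= a -> norm2 (a *: u) = a * norm2 u.
Proof.
by move=> a0; rewrite /norm2 dot2Z -expr2 sqrtrM ?sqr_ge0 // sqrtr_sqr ger0_norm.
Qed.

Lemma norm2_normalize u : u != 0 -> norm2 ((norm2 u)^-1 *: u) = 1.
Proof.
by move=> /norm2_gt0 u0; rewrite norm2Z ?invr_ge0 ?ltW // mulVf // gt_eqF.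
Qed.

(* [v] is the product of [z] and [u] as complex numbers. *)
Definition spiral z u v : Prop :=
  v 0 0 = z.1 * u 0 0 - z.2 * u 1 0 /\ v 1 0 = z.2 * u 0 0 + z.1 * u 1 0.

Lemma spiralD z u u' v v' :
  spiral z u v -> spiral z u' v' -> spiral z (u + u') (v + v').
Proof. by move=> [a b] [c d]; split; rewrite !mxE ?a ?b ?c ?d; ring. Qed.

Lemma spiralN z u v : spiral z u v -> spiral z (- u) (- v).
Proof. by move=> [a b]; split; rewrite !mxE ?a ?b; ring. Qed.

Lemma spiral0 z : spiral z 0 0.
Proof. by split; rewrite !mxE; ring. Qed.

Lemma spiral_exists u v : u != 0 -> exists z, spiral z u v.
Proof.
move=> /dot2_gt0 u0; have uN : dot2 u u != 0 by rewrite gt_eqF.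
(* The complex quotient [v / u]: [dot2 u v] and [cross2 u v] are the real and imaginary parts of
   [conj(u) v]. *)
exists (dot2 u v / dot2 u u, cross2 u v / dot2 u u).
by move: uN; rewrite /dot2 /cross2 => uN; split=> /=; field.
Qed.

Lemma spiral_inj z z' u v : u != 0 -> spiral z u v -> spiral z' u v -> z = z'.
Proof.
move=> /dot2_gt0; case: z z' => [a b] [a' b']; rewrite /spiral /dot2 /=.
move=> u0 [-> ->] [e0 e1].
have uN : u 0 0 * u 0 0 + u 1 0 * u 1 0 != 0 by rewrite gt_eqF.
congr pair; apply: (mulIf uN); apply/eqP; rewrite -subr_eq0; apply/eqP.
  transitivity (u 0 0 * ((a * u 0 0 - b * u 1 0) - (a' * u 0 0 - b' * u 1 0))
     + u 1 0 * ((b * u 0 0 + a * u 1 0) - (b' * u 0 0 + a' * u 1 0))).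
    by ring.
  by rewrite e0 e1; ring.
transitivity (u 0 0 * ((b * u 0 0 + a * u 1 0) - (b' * u 0 0 + a' * u 1 0))
   - u 1 0 * ((a * u 0 0 - b * u 1 0) - (a' * u 0 0 - b' * u 1 0))).
  by ring.
by rewrite e0 e1; ring.
Qed.

Lemma spiral_neq0 z u v : spiral z u v -> v != 0 -> 0 < z.1 ^+ 2 + z.2 ^+ 2.
Proof.
move=> [v0 v1]; apply: contraNT; rewrite -leNgt => zN.
have z1 : z.1 = 0 by nra.
have z2 : z.2 = 0 by nra.
by apply/eqP/col2P; rewrite mxE ?v0 ?v1 z1 z2; ring.
Qed.

(* Equality of the oriented angles, resp. of the length ratios, of two pairs of
   vectors, in a form free of normalization. *)
Definition same_angle u v u' v' : Prop :=
  exists2 r : R, 0 < r &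
    dot2 u' v' = r * dot2 u v /\ cross2 u' v' = r * cross2 u v.

Definition same_ratio u v u' v' : Prop :=
  dot2 v' v' * dot2 u u = dot2 v v * dot2 u' u'.

(** * Consequences of equal angles and equal ratios for the complex factor *)

Lemma same_angleC u v u' v' : same_angle u v u' v' -> same_angle v u v' u'.
Proof.
move=> [r r0 [d c]]; exists r => //; move: d c; rewrite /dot2 /cross2.
by split; lra.
Qed.

Lemma same_ratioC u v u' v' : same_ratio u v u' v' -> same_ratio v u v' u'.
Proof. by rewrite /same_ratio => E; rewrite mulrC -E mulrC. Qed.

(** In complex terms [conj(u') v' = r conj(u) v]; with [u' = z u] this gives [v' = r v / conj(z)],
    that is [(r / |z|^2) z v]. *)
Lemma same_angle_spiral z u v u' v' : u != 0 -> u' != 0 ->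
    spiral z u u' -> same_angle u v u' v' ->
  exists2 t, 0 < t & spiral (t * z.1, t * z.2) v v'.
Proof.
move=> u0 u'0 zu; have z0 := spiral_neq0 zu u'0.
move: zu (dot2_gt0 u0) => [zu0 zu1] uu [r r0 [d c]].
exists (r / (z.1 ^+ 2 + z.2 ^+ 2)); first exact: divr_gt0.
have zN : z.1 ^+ 2 + z.2 ^+ 2 != 0 by rewrite gt_eqF.
have uN : dot2 u u != 0 by rewrite gt_eqF.
move: d c uN; rewrite /dot2 /cross2 zu0 zu1 => d c uN.
have main (x y : R) : (z.1 ^+ 2 + z.2 ^+ 2) * (u 0 0 * u 0 0 + u 1 0 * u 1 0) * x
    = (z.1 ^+ 2 + z.2 ^+ 2) * (u 0 0 * u 0 0 + u 1 0 * u 1 0) * y -> x = y.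
  by apply: mulfI; rewrite mulf_neq0.
(* Each coordinate is checked after multiplying by [|u'|^2 = |z|^2 |u|^2], through the expansion of
   [u' (conj(u') v')]. *)
split=> /=; apply: main.
  transitivity ((z.1 * u 0 0 - z.2 * u 1 0) *
       (r * (u 0 0 * v 0 0 + u 1 0 * v 1 0))
     - (z.2 * u 0 0 + z.1 * u 1 0) * (r * (u 0 0 * v 1 0 - u 1 0 * v 0 0))).
    by rewrite -d -c; ring.
  by field.
transitivity ((z.2 * u 0 0 + z.1 * u 1 0) *
     (r * (u 0 0 * v 0 0 + u 1 0 * v 1 0))
   + (z.1 * u 0 0 - z.2 * u 1 0) * (r * (u 0 0 * v 1 0 - u 1 0 * v 0 0))).
  by rewrite -d -c; ring.
by field.
Qed.

Lemma spiral_dot2 z u v u' v' : spiral z u u' -> spiral z v v' ->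
  dot2 u' v' = (z.1 ^+ 2 + z.2 ^+ 2) * dot2 u v.
Proof. by rewrite /dot2 => -[-> ->] [-> ->]; ring. Qed.

(** The angle gives [v' = t z v] with [t > 0]; the ratio gives [t ^+ 2 = 1]. *)
Lemma same_angle_ratio_spiral z u v u' v' : u != 0 -> u' != 0 -> v != 0 ->
    spiral z u u' -> same_angle u v u' v' -> same_ratio u v u' v' ->
  spiral z v v'.
Proof.
move=> u0 u'0 v0 zu ang; have [t t0 tv] := same_angle_spiral u0 u'0 zu ang.
rewrite /same_ratio (spiral_dot2 zu zu) (spiral_dot2 tv tv) /=.
have zN : z.1 ^+ 2 + z.2 ^+ 2 != 0 by rewrite gt_eqF // (spiral_neq0 zu u'0).
have uN : dot2 u u != 0 by rewrite gt_eqF ?dot2_gt0.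
have vN : dot2 v v != 0 by rewrite gt_eqF ?dot2_gt0.
move=> E; suff t1 : t = 1 by move: tv; rewrite t1 !mul1r -surjective_pairing.
have : t ^+ 2 = 1.
  apply: (mulIf (mulf_neq0 zN (mulf_neq0 uN vN))); rewrite mul1r.
  by transitivity (((t * z.1) ^+ 2 + (t * z.2) ^+ 2) * dot2 v v * dot2 u u);
    [ring|rewrite E; ring].
by move/eqP; rewrite pexpr_eq1 ?ltW // => /eqP.
Qed.

(* With [x = \overrightarrow{a d}] and [y = \overrightarrow{a v}]: the angle at
   [a] confines [v] to a ray, and the ratio at [d] to a circle, which can meet
   the ray twice; the angle or the ratio at [v] separates the two points. *)
Lemma triangle_spiral z x y x' y' : x != 0 -> x' != 0 -> y != 0 -> y - x != 0 ->
    spiral z x x' -> same_angle x y x' y' ->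
    same_ratio (- x) (y - x) (- x') (y' - x') ->
    same_angle (- y) (x - y) (- y') (x' - y') \/
      same_ratio (- y) (x - y) (- y') (x' - y') ->
  spiral z y y'.
Proof.
move=> x0 x'0 y0 xy0 zx ang; have [t t0 ty] := same_angle_spiral x0 x'0 zx ang.
have zN := spiral_neq0 zx x'0.
(* Since [x' = z x] and [y' = z w], every primed length and inner product is [|z|^2] times that of
   the triangle [0, x, w], and [t = 1] remains to be shown. *)
pose w := t *: y.
have zw : spiral z w y'.
  by case: ty => /= e0 e1; split; rewrite /w !mxE /= ?e0 ?e1; ring.
have zwx := spiralD zw (spiralN zx).
have zxw := spiralD zx (spiralN zw).
have xx := dot2_gt0 x0; have yy := dot2_gt0 y0; have yx := dot2_gt0 xy0.
rewrite /same_ratio /same_angle (spiral_dot2 zwx zwx).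
rewrite (spiral_dot2 (spiralN zx) (spiralN zx)) (spiral_dot2 zxw zxw).
rewrite (spiral_dot2 (spiralN zw) (spiralN zw)) (spiral_dot2 (spiralN zw) zxw).
set Z := z.1 ^+ 2 + z.2 ^+ 2 in zN *.
have ZN : Z != 0 by rewrite gt_eqF.
have E1 : dot2 (w - x) (w - x) =
    t ^+ 2 * dot2 y y - 2 * t * dot2 y x + dot2 x x.
  by rewrite /dot2 ?/w !mxE; ring.
have E1' : dot2 (x - w) (x - w) = dot2 (w - x) (w - x).
  by rewrite /dot2 ?/w !mxE; ring.
have E2 : dot2 (y - x) (y - x) = dot2 y y - 2 * dot2 y x + dot2 x x.
  by rewrite /dot2 ?/w !mxE; ring.
have E2' : dot2 (x - y) (x - y) = dot2 (y - x) (y - x).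
  by rewrite /dot2 ?/w !mxE; ring.
have E3 : dot2 (- w) (x - w) = t * (t * dot2 y y - dot2 y x).
  by rewrite /dot2 ?/w !mxE; ring.
have E4 : dot2 (- y) (x - y) = dot2 y y - dot2 y x.
  by rewrite /dot2 ?/w !mxE; ring.
have E5 u : dot2 (- u) (- u) = dot2 u u by rewrite /dot2 ?/w !mxE; ring.
have E6 : dot2 w w = t ^+ 2 * dot2 y y by rewrite dot2Z expr2.
rewrite E1' E2' E3 E4 !E5 E6 => C1.
have {}C1 : dot2 (w - x) (w - x) = dot2 (y - x) (y - x).
  apply: (mulIf (mulf_neq0 ZN (lt0r_neq0 xx))).
  by rewrite mulrA [_ * Z]mulrC C1; ring.
suff t1 : t = 1 -> spiral z y y'.
  move=> C2; apply: t1; move: C2.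
  (* By [C1], [w] and [y] lie on one circle around [x]; the second factor describes the other
     intersection with the ray. *)
  have Yt : (t - 1) * ((t + 1) * dot2 y y - 2 * dot2 y x) = 0.
    by move: C1; rewrite E1 E2 => C1; lra.
  case=> [[r r0 [C2 _]]|].
    move/eqP: Yt; rewrite mulf_eq0 => /orP[/eqP|/eqP] Yt; first by lra.
    (* At the other intersection the inner product at [v] changes sign up to a positive factor,
       while equal angles forbid this unless it vanishes. Then the ray is tangent to the circle and
       the two points coincide. *)
    have K : (Z * t + r) * (dot2 y y - dot2 y x) = 0.
      rewrite mulrDl -C2.
      have -> : dot2 y y - dot2 y x = - (t * dot2 y y - dot2 y x) by lra.
      by ring.
    have s0 : 0 < Z * t + r by rewrite addr_gt0 ?mulr_gt0.
    move/eqP: K; rewrite mulf_eq0 (gt_eqF s0) /= => /eqP K.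
    have : (t - 1) * dot2 y y = 0 by lra.
    by move/eqP; rewrite mulf_eq0 (gt_eqF yy) orbF => /eqP; lra.
  (* The sides from [v] to [d] already agree up to [|z|], so the ratio at [v] compares [w] with [y]
     in length. *)
  rewrite C1 => C2.
  have : t ^+ 2 = 1.
    apply: (mulIf (mulf_neq0 ZN (mulf_neq0 (lt0r_neq0 yy) (lt0r_neq0 yx)))).
    rewrite mul1r; apply/esym.
    by transitivity (Z * dot2 (y - x) (y - x) * dot2 y y); [ring|rewrite C2; ring].
  by move/eqP; rewrite pexpr_eq1 ?ltW // => /eqP.
by move=> t1; move: zw; rewrite /w t1 scale1r.
Qed.

(** Polar form of [z]: the modulus is the norm of the vector [w], and the argument is the signed
    angle from [o], the number 1, to [w] normalized. *)
Lemma spiral_rot2 z : 0 < z.1 ^+ 2 + z.2 ^+ 2 -> exists theta c : R,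
  [/\ 0 <= theta < pi *+ 2, 0 < c &
      forall u v, spiral z u v -> v = c *: (rot2 theta *m u)].
Proof.
move=> z0; pose w : 'cV[R]_2 := \col_i (if i == 0 then z.1 else z.2).
have [w0 w1] : w 0 0 = z.1 /\ w 1 0 = z.2 by rewrite !mxE.
pose o : 'cV[R]_2 := \col_i (if i == 0 then 1 else 0).
have [o0 o1] : o 0 0 = 1 /\ o 1 0 = 0 by rewrite !mxE.
have oN : norm2 o = 1 by rewrite /norm2 /dot2 o0 o1 mulr1 mulr0 addr0 sqrtr1.
have wN : w != 0.
  apply: contraTneq z0 => E; rewrite -w0 -w1 E !mxE.
  by rewrite expr0n addr0 ltxx.
have c0 := norm2_gt0 wN.
have [th cth sth] := cos_sin_signed_angle oN (norm2_normalize wN).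
exists (signed_angle o ((norm2 w)^-1 *: w)), (norm2 w); split=> // u v [v0 v1].
have cN : norm2 w != 0 by rewrite gt_eqF.
have oE v' : dot2 o v' = v' 0 0 /\ cross2 o v' = v' 1 0.
  by rewrite /dot2 /cross2 o0 o1; split; ring.
move: cth sth; rewrite !(oE _).1 !(oE _).2 ![(_ *: w) _ _]mxE w0 w1 => cth sth.
by apply: col2P; rewrite mxE rot2_mulE cth sth ?v0 ?v1 /=; field.
Qed.

(** Cosine and sine of the signed angle are the inner and cross products of the unit vectors;
    undoing the normalization produces the positive factor. *)
Lemma same_angle_of_signed_angle u v u' v' :
    u != 0 -> v != 0 -> u' != 0 -> v' != 0 ->
    signed_angle ((norm2 u')^-1 *: u') ((norm2 v')^-1 *: v') =
    signed_angle ((norm2 u)^-1 *: u) ((norm2 v)^-1 *: v) ->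
  same_angle u v u' v'.
Proof.
move=> u0 v0 u'0 v'0 E.
have [_ c s] := cos_sin_signed_angle (norm2_normalize u0) (norm2_normalize v0).
have [_] := cos_sin_signed_angle (norm2_normalize u'0) (norm2_normalize v'0).
rewrite E c s !dot2Z !cross2Z => dE cE.
move: (norm2_gt0 u0) (norm2_gt0 v0) (norm2_gt0 u'0) (norm2_gt0 v'0) => a b a' b'.
exists (norm2 u' * norm2 v' / (norm2 u * norm2 v)).
  by rewrite divr_gt0 // mulr_gt0.
have [aN bN] : norm2 u != 0 /\ norm2 v != 0 by rewrite !gt_eqF.
have N : (norm2 u')^-1 * (norm2 v')^-1 != 0.
  by rewrite mulf_neq0 // invr_neq0 // gt_eqF.
have [a'N b'N] : norm2 u' != 0 /\ norm2 v' != 0 by rewrite !gt_eqF.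
by split; apply: (mulfI N); rewrite -?dE -?cE; field; apply/and4P.
Qed.

Lemma same_ratio_of_norm2 u v u' v' : u != 0 -> u' != 0 ->
  norm2 v' / norm2 u' = norm2 v / norm2 u -> same_ratio u v u' v'.
Proof.
move=> /norm2_gt0/lt0r_neq0 u0 /norm2_gt0/lt0r_neq0 u'0 /eqP.
rewrite eqr_div // => /eqP E; rewrite /same_ratio.
by rewrite -(sqr_norm2 u) -(sqr_norm2 v) -(sqr_norm2 u') -(sqr_norm2 v') -!exprMn E.
Qed.

End PlaneGeometry.

(** * Frameworks: from equal data to spiral relations between edge vectors *)

Section Rigidity.
Variables (R : realType) (n : nat).
Implicit Types (e : rel 'I_n) (A D S : {set 'I_n}) (p q : config R n).

Lemma SA_RoD_fiberP e A D p q : SA_RoD_fiber e A D p q <->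
  [/\ adjacent_distinct e q,
      forall t, t \in triples_at e A -> SA q t = SA p t &
      forall t, t \in triples_at e D -> RoD q t = RoD p t].
Proof.
split=> [[qd [/ffunP EA /ffunP ED]]|[qd EA ED]].
  by split=> // t tS; [have := EA (exist _ t tS)|have := ED (exist _ t tS)];
    rewrite !ffunE.
by split=> //; congr pair; apply/ffunP => -[t tS]; rewrite !ffunE /=; auto.
Qed.

Lemma adjacent_sub_neq0 e p i j : adjacent_distinct e p -> e i j ->
  p j - p i != 0.
Proof. by move=> pd /pd ij; rewrite subr_eq0 eq_sym; apply/eqP. Qed.

Lemma injective_adjacent_distinct e p : irreflexive e -> injective p ->
  adjacent_distinct e p.
Proof. by move=> irr p_inj i j eij /p_inj ij; move: eij; rewrite ij irr. Qed.

Lemma mem_triples_at e S i j k :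
  (i, j, k) \in triples_at e S = [&& e i j, e i k, (j < k)%N & i \in S].
Proof. by rewrite !inE /= -!andbA. Qed.

Lemma triples_setT e : triples_at e [set: 'I_n]%SET = triples e.
Proof. by apply/finset.setP => t; rewrite !inE andbT. Qed.

(** Triples list the two neighbours in increasing order only; the symmetry [same_angleC] supplies
    the other order. *)
Lemma SA_same_angle e S p q i j k :
    adjacent_distinct e p -> adjacent_distinct e q ->
    (forall t, t \in triples_at e S -> SA q t = SA p t) ->
    i \in S -> e i j -> e i k -> j != k ->
  same_angle (p j - p i) (p k - p i) (q j - q i) (q k - q i).
Proof.
move=> pd qd E iS; wlog jk : j k / (j < k)%N => [W ij ik njk|ij ik _].
  case: (ltngtP j k) => [jk|kj|/val_inj jk]; first exact: W.
    by apply: same_angleC; apply: W; rewrite // eq_sym.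
  by rewrite jk eqxx in njk.
apply: same_angle_of_signed_angle; rewrite ?(adjacent_sub_neq0 (e := e)) //.
by apply: (E (i, j, k)); rewrite mem_triples_at ij ik jk.
Qed.

Lemma RoD_same_ratio e S p q i j k :
    adjacent_distinct e p -> adjacent_distinct e q ->
    (forall t, t \in triples_at e S -> RoD q t = RoD p t) ->
    i \in S -> e i j -> e i k -> j != k ->
  same_ratio (p j - p i) (p k - p i) (q j - q i) (q k - q i).
Proof.
move=> pd qd E iS; wlog jk : j k / (j < k)%N => [W ij ik njk|ij ik _].
  case: (ltngtP j k) => [jk|kj|/val_inj jk]; first exact: W.
    by apply: same_ratioC; apply: W; rewrite // eq_sym.
  by rewrite jk eqxx in njk.
apply: same_ratio_of_norm2; rewrite ?(adjacent_sub_neq0 (e := e)) //.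
by apply: (E (i, j, k)); rewrite mem_triples_at ij ik jk.
Qed.

(** The vertex [i] guarantees that [z] is nonzero, so its polar form yields the rotation and the
    scaling; the translation is fixed by the image of [o]. *)
Lemma spiral_directly_similar p q z o i : q i != q o ->
  (forall j, spiral z (p j - p o) (q j - q o)) -> directly_similar p q.
Proof.
move=> qio zs; have qN : q i - q o != 0 by rewrite subr_eq0.
have [th [c [thP c0 E]]] := spiral_rot2 (spiral_neq0 (zs i) qN).
exists (q o - c *: (rot2 th *m p o)), th, c; split=> // j.
rewrite -[LHS](subrK (q o)) (E _ _ (zs j)) mulmxBr scalerBr.
by rewrite addrAC -addrA [RHS]addrC [q o - _]addrC addrA.
Qed.

(** * Invariance of angles and ratios under direct similarities *)

Lemma signed_angle_rot2 theta (u v : 'cV[R]_2) :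
  signed_angle (rot2 theta *m u) (rot2 theta *m v) = signed_angle u v.
Proof.
have sc := cos2Dsin2 theta.
have dE : dot2 (rot2 theta *m u) (rot2 theta *m v) = dot2 u v.
  by rewrite -[RHS]mul1r -sc /dot2 !rot2_mulE; ring.
have cE : cross2 (rot2 theta *m u) (rot2 theta *m v) = cross2 u v.
  by rewrite -[RHS]mul1r -sc /cross2 !rot2_mulE; ring.
by rewrite /signed_angle dE cE.
Qed.

Lemma norm2_rot2 theta (u : 'cV[R]_2) : norm2 (rot2 theta *m u) = norm2 u.
Proof.
rewrite /norm2; congr Num.sqrt.
by rewrite -[RHS]mul1r -(cos2Dsin2 theta) /dot2 !rot2_mulE; ring.
Qed.

Lemma directly_similar_inj p q : injective p -> directly_similar p q ->
  injective q.
Proof.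
move=> p_inj [xi [th [c [_ c0 E]]]] i j; rewrite !E.
move=> /addrI /(scalerI (lt0r_neq0 c0)) /eqP; rewrite -subr_eq0 -mulmxBr => ij.
apply: p_inj; apply/eqP; rewrite -subr_eq0.
apply: contraLR ij => /norm2_gt0; rewrite -(norm2_rot2 th).
by apply: contraTneq => ->; rewrite /norm2 /dot2 !mxE mulr0 addr0 sqrtr0 ltxx.
Qed.

(** Edge vectors are rotated and scaled by one [c], which cancels in bearings and ratios; signed
    angles ignore the common rotation. *)
Lemma directly_similar_determined p q t : injective p -> directly_similar p q ->
    t \in triples complete_graph ->
  [/\ SA_RoD_defined q t, SA q t = SA p t & RoD q t = RoD p t].
Proof.
move=> p_inj pq; case: t => [[i j] k]; have [xi [th [c [_ c0 E]]]] := pq.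
rewrite !inE /= => /and3P[ij ik _].
have qB l : q l - q i = c *: (rot2 th *m (p l - p i)).
  by rewrite !E mulmxBr scalerBr opprD addrACA subrr add0r.
have nB l : norm2 (q l - q i) = c * norm2 (p l - p i).
  by rewrite qB norm2Z ?ltW // norm2_rot2.
have bB l : bearing q i l = rot2 th *m bearing p i l.
  rewrite /bearing nB qB -scalemxAr scalerA; congr (_ *: _).
  by rewrite invfM mulrAC mulVf ?mul1r // gt_eqF.
have q_inj := directly_similar_inj p_inj pq.
split; first by split=> /q_inj /esym/eqP; apply/negP.
  by rewrite !bB signed_angle_rot2.
by rewrite !nB -mulf_div divff ?mul1r // gt_eqF.
Qed.

(** * Fibers of a graph and of the complete graph *)

Lemma complete_graph_irr : irreflexive (@complete_graph n).
Proof. by move=> i; rewrite /complete_graph /= eqxx. Qed.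

Lemma subset_triples_at e S : irreflexive e ->
  triples_at e S \subset triples_at complete_graph S.
Proof.
move=> irr; apply/fintype.subsetP => -[[i j] k]; rewrite !mem_triples_at.
move=> /and4P[ij ik -> ->]; rewrite /= !andbT; apply/andP.
by split; [move: ij|move: ik]; apply: contraTneq => <-; rewrite irr.
Qed.

Lemma subset_triples_complete e S : irreflexive e ->
  triples_at e S \subset triples complete_graph.
Proof.
move=> irr; apply: fintype.subset_trans (subset_triples_at S irr) _.
by apply/fintype.subsetP => t; rewrite inE => /andP[].
Qed.

Lemma directly_similar_adjacent_distinct e p q : irreflexive e -> injective p ->
  directly_similar p q -> adjacent_distinct e q.
Proof.
move=> irr p_inj pq; apply: injective_adjacent_distinct irr _.
exact: directly_similar_inj pq.
Qed.

Lemma directly_similar_fiber e A D p q : irreflexive e -> injective p ->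
  directly_similar p q -> SA_RoD_fiber e A D p q.
Proof.
move=> irr p_inj pq; apply/SA_RoD_fiberP; split.
- exact: directly_similar_adjacent_distinct pq.
- move=> t /(fintype.subsetP (subset_triples_complete _ irr)).
  by case/(directly_similar_determined p_inj pq).
- move=> t /(fintype.subsetP (subset_triples_complete _ irr)).
  by case/(directly_similar_determined p_inj pq).
Qed.

Lemma fiber_complete_subset e A D p q : irreflexive e ->
  SA_RoD_fiber complete_graph A D p q -> SA_RoD_fiber e A D p q.
Proof.
move=> irr /SA_RoD_fiberP[qd EA ED]; apply/SA_RoD_fiberP; split.
- by move=> i j ij; apply: qd; apply: contraTneq ij => /= ->; rewrite irr.
- by move=> t /(fintype.subsetP (subset_triples_at _ irr))/EA.
- by move=> t /(fintype.subsetP (subset_triples_at _ irr))/ED.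
Qed.

Lemma fiber_complete_similar A D p q : bipartition A D -> injective p ->
  SA_RoD_fiber complete_graph A D p q -> directly_similar p q.
Proof.
move=> [/finset.set0Pn[a aA] /finset.set0Pn[d dD] AD ADI] p_inj.
move=> /SA_RoD_fiberP[qd EA ED].
have pd := injective_adjacent_distinct complete_graph_irr p_inj.
have ad : a != d.
  apply: contraTneq aA => ->; apply/negP => dA.
  have : d \in A :&: D by rewrite inE dA.
  by rewrite ADI inE.
have N i j : i != j -> (p j - p i != 0) * (q j - q i != 0).
  by move=> ij; rewrite !(adjacent_sub_neq0 (e := complete_graph)).
have [z zx] := spiral_exists (q d - q a) (N _ _ ad).1.
apply: (@spiral_directly_similar p q z a d) => [|v].
  by rewrite -subr_eq0 (N _ _ ad).2.
have [->|va] := eqVneq v a; first by rewrite !subrr; apply: spiral0.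
have [->//|vd] := eqVneq v d.
have [av da dv] : [/\ a != v, d != a & d != v] by split; rewrite eq_sym.
have [px qx] := N _ _ ad; have [py _] := N _ _ av; have [pxy _] := N _ _ dv.
have eB f (i j k : 'I_n) : (f j - f i) - (f k - f i) = f j - f k :> 'cV[R]_2.
  by rewrite opprB addrA subrK.
(* The triangle [a, d, v] with origin at [a]: what remains is the angle at [a], the ratio at [d],
   and at [v] the datum of its own class. *)
apply: (triangle_spiral px qx py) => //; rewrite ?eB ?opprB //.
- exact: SA_same_angle pd qd EA aA _ _ _.
- exact: RoD_same_ratio pd qd ED dD _ _ _.
- have : v \in A :|: D by rewrite AD inE.
  rewrite inE => /orP[vA|vD]; [left|right].
    exact: SA_same_angle pd qd EA vA _ _ _.
  exact: RoD_same_ratio pd qd ED vD _ _ _.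
Qed.

(** * Reconstruction from determined triples *)

Lemma third_vertex (i j : 'I_n) : (3 <= n)%N -> exists2 k, i != k & j != k.
Proof.
move=> n3; have : (0 < #|~: [set i; j]%SET|)%N.
  by rewrite -(ltn_add2l #|[set i; j]%SET|) cardsC card_ord addn0
    (leq_ltn_trans _ n3) // cards2; case: (_ != _).
move=> /card_gt0P[k]; rewrite !inE negb_or ![k == _]eq_sym => /andP[ik jk].
by exists k.
Qed.

(** Membership in the fiber also requires distinct positions. A third vertex places each pair in a
    triple centred at one of its members, and definedness there separates the pair. *)
Lemma determined_complete_fiber A D p q : (3 <= n)%N ->
    (forall t, t \in triples complete_graph ->
       [/\ SA_RoD_defined q t, SA q t = SA p t & RoD q t = RoD p t]) ->
  SA_RoD_fiber complete_graph A D p q.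
Proof.
move=> n3 E; apply/SA_RoD_fiberP.
have sub S := fintype.subsetP (subset_triples_complete S complete_graph_irr).
split=> [|t /sub/E[]//|t /sub/E[]//].
rewrite /adjacent_distinct /complete_graph /= => i j ij.
have [k ik jk] := third_vertex i j n3.
case: (ltngtP j k) => [jk'|kj|/val_inj jk'].
- have /E[[qji _] _ _] : (i, j, k) \in triples complete_graph.
    by rewrite inE /complete_graph /= ij ik.
  by move=> /esym.
- have /E[[_ qji] _ _] : (i, k, j) \in triples complete_graph.
    by rewrite inE /complete_graph /= ij ik.
  by move=> /esym.
- by rewrite jk' eqxx in jk.
Qed.

(* Around each vertex the angles and ratios fix the spiral similarity taking the
   star of [p] to that of [q]; the stars of adjacent vertices share an edge. *)
Lemma determined_connected_similar e p q : (3 <= n)%N -> symmetric e ->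
    irreflexive e -> injective p -> connected_graph e ->
    adjacent_distinct e q ->
    (forall t, t \in triples e ->
       [/\ SA_RoD_defined q t, SA q t = SA p t & RoD q t = RoD p t]) ->
  directly_similar p q.
Proof.
move=> n3 sym irr p_inj conn qd E.
have pd := injective_adjacent_distinct irr p_inj.
have N i j : e i j -> (p j - p i != 0) * (q j - q i != 0).
  by move=> ij; rewrite !(adjacent_sub_neq0 (e := e)).
have EA t : t \in triples_at e [set: 'I_n]%SET -> SA q t = SA p t.
  by rewrite triples_setT => /E[].
have ED t : t \in triples_at e [set: 'I_n]%SET -> RoD q t = RoD p t.
  by rewrite triples_setT => /E[].
have star z u v w : e u v -> spiral z (p v - p u) (q v - q u) -> e u w ->
    spiral z (p w - p u) (q w - q u).
  move=> uv zv uw; have [<-//|vw] := eqVneq v w.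
  apply: (same_angle_ratio_spiral _ _ _ zv); rewrite ?N //.
    by apply: SA_same_angle pd qd EA _ _ _ _; rewrite ?inE.
  by apply: RoD_same_ratio pd qd ED _ _ _ _; rewrite ?inE.
(* The vertices 0 and 1: a path between two distinct vertices has a first edge, which defines
   [z]. *)
pose o : 'I_n := Ordinal (ltn_trans (ltn0Sn 1) n3).
pose o' : 'I_n := Ordinal (ltn_trans (ltnSn 1) n3).
have [i oi] : exists i, e o i.
  have /connectP[[|i s]] := conn o o'; first by move=> _ /(congr1 val).
  by move=> /= /andP[oi _] _; exists i.
have [z zi] := spiral_exists (q i - q o) (N _ _ oi).1.
apply: (@spiral_directly_similar p q z o i) => [|j].
  by rewrite -subr_eq0 (N _ _ oi).2.
have /connectP[s es ->] := conn o j.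
(* Invariant along the path: [z] transforms both the position of [x] relative to [o] and the whole
   star of [x]. *)
suff : forall x, spiral z (p x - p o) (q x - q o) ->
    (forall y, e x y -> spiral z (p y - p x) (q y - q x)) -> path e x s ->
    spiral z (p (last x s) - p o) (q (last x s) - q o).
  apply=> //; first by rewrite !subrr; apply: spiral0.
  by move=> y; apply: star oi zi.
elim: s {es} => //= y s IH x zx stx /andP[xy ys].
have zy := stx _ xy.
apply: IH ys => [|w yw]; last first.
  (* The star of [y] inherits [z] from the edge back to [x], whose vectors are only negated. *)
  apply: (star _ _ x) => //; first by rewrite sym.
  by rewrite -(opprB (p y)) -(opprB (q y)); apply: spiralN.
have addB f : (f x - f o) + (f y - f x) = f y - f o :> 'cV[R]_2.
  by rewrite addrC addrA subrK.
by have := spiralD zx zy; rewrite !addB.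
Qed.

End Rigidity.

(** The third statement appears as two separate implications because its return to rigidity fails
    for the edgeless graph, by [edgeless_triples_determined] and [edgeless_shape_not_determined]. *)
Theorem theorem3 (R : realType) (n : nat) (e : rel 'I_n)
    (A D : {set 'I_n}) (p : config R n)
    (n_ge3 : (3 <= n)%N)
    (e_sym : symmetric e) (e_irr : irreflexive e)
    (AD : bipartition A D)
    (p_inj : injective p) :
  [/\ globally_SA_RoD_rigid e A D p <-> shape_determined e A D p,
      globally_SA_RoD_rigid e A D p <->
        SA_RoD_determined e A D p (triples complete_graph),
      globally_SA_RoD_rigid e A D p -> SA_RoD_determined e A D p (triples e)
    & connected_graph e ->
        SA_RoD_determined e A D p (triples e) -> globally_SA_RoD_rigid e A D p].
Proof.
have rigid_shape : globally_SA_RoD_rigid e A D p -> shape_determined e A D p.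
  by move=> rig q; rewrite rig; apply: fiber_complete_similar.
have shape_rigid : shape_determined e A D p -> globally_SA_RoD_rigid e A D p.
  (* The fiber of the complete graph is always the smaller one, and it contains every direct
     similarity of [p]. *)
  move=> shp; apply/seteqP; split=> q; last exact: fiber_complete_subset.
  by move=> /shp; apply: directly_similar_fiber => //; apply: complete_graph_irr.
have shape_complete : shape_determined e A D p ->
    SA_RoD_determined e A D p (triples complete_graph).
  by move=> shp q /shp pq t; apply: directly_similar_determined.
split.
- by split.
- split=> [/rigid_shape/shape_complete//|det].
  apply/seteqP; split=> q; last exact: fiber_complete_subset.
  by move=> /det; apply: determined_complete_fiber.
- move=> /rigid_shape/shape_complete det q /det E t.
  rewrite -triples_setT.
  by move=> /(fintype.subsetP (subset_triples_complete _ e_irr)); apply: E.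
- move=> conn det; apply: shape_rigid => q qF.
  have [qd _] := qF.
  exact: determined_connected_similar (det q qF).
Qed.
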